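(* Let $\mathcal H$ be a real Hilbert space, $A:\mathcal H\rightrightarrows\mathcal H$ a maximal monotone operator, $\theta>0$. Assume that $S=A^{-1}(0)$ is non-empty and that there exist $\varepsilon,\kappa>0$ such that $$v\in A(x),\ \|v\|\le\varepsilon\ \Longrightarrow\ d(x,S)\le\kappa\|v\|.$$ Given $x_0\notin S$, let $(x,\lambda):[0,+\infty[\to\mathcal H\times\mathbb R_{++}$ be the unique global solution of $$\begin{cases}\dot x(t)+x(t)-(I+\lambda(t)A)^{-1}x(t)=0,\quad \lambda(t)>0,\\ \lambda(t)\,\|(I+\lambda(t)A)^{-1}x(t)-x(t)\|=\theta,\\ x(0)=x_0,\end{cases}$$ and set $v(t)=\lambda(t)^{-1}\big(x(t)-(I+\lambda(t)A)^{-1}x(t)\big)$. Then $x(t)$ converges strongly, as $t\to+\infty$, to some $x^*\in A^{-1}(0)$, and for any $\alpha\in(0,1)$ there exist positive reals $c_0,c_1,c_2,c_3$ such that, for all $t\ge0$, $$d(x(t),S)\le c_0e^{-\alpha t},\quad \lambda(t)\ge c_1e^{\alpha t},\quad \|v(t)\|\le c_2e^{-2\alpha t},\quad \|x(t)-x^*\|\le c_3e^{-\alpha t}.$$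
   Context: $A^{-1}(0)=\{x\in\mathcal H:0\in Ax\}$; $d(x,S)=\inf_{z\in S}\|x-z\|$. Existence and uniqueness of the global solution $(x,\lambda)$ (with $x$ of class $\mathscr C^1$ and $\lambda$ locally Lipschitz continuous) holds for every $x_0\notin A^{-1}(0)$. *)

(* Defs.v *)
From HB Require Import structures.
From mathcomp Require Import all_boot all_order all_algebra.
From mathcomp Require Import all_classical all_reals all_analysis.
Set Implicit Arguments.
Unset Strict Implicit.
Unset Printing Implicit Defensive.
Import Order.TTheory GRing.Theory Num.Theory.
Import numFieldNormedType.Exports.
Local Open Scope classical_set_scope.
Local Open Scope ring_scope.

(* A set-valued operator on [H] is a function [A : H -> set H]; [A y v] reads
   "v belongs to A(y)". *)

Definition monotone (R : realType) (H : completeNormedModType R)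
    (dot : H -> H -> R) (A : H -> set H) : Prop :=
  forall y z u v, A y u -> A z v -> 0 <= dot (y - z) (u - v).

Definition maximal_monotone (R : realType) (H : completeNormedModType R)
    (dot : H -> H -> R) (A : H -> set H) : Prop :=
  monotone dot A /\
  forall B : H -> set H, monotone dot B ->
    (forall y, A y `<=` B y) -> forall y, B y = A y.

Definition zeros (R : realType) (H : completeNormedModType R)
    (A : H -> set H) : set H := [set y | A y 0].

Definition dist (R : realType) (H : completeNormedModType R)
    (y : H) (S : set H) : R := inf [set `|y - z| | z in S].

Definition id_plus (R : realType) (H : completeNormedModType R)
    (l : R) (A : H -> set H) : H -> set H :=
  fun y => [set y + l *: v | v in A y].

(* [(I + l A)^-1 y]. When [A] is maximal monotone and [0 < l], the set below
   is a singleton for every [y] (Minty), so the default value [y] is never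
   used. *)
Definition resolvent (R : realType) (H : completeNormedModType R)
    (A : H -> set H) (l : R) (y : H) : H :=
  xget y [set z | id_plus l A z y].

(* [w] is the derivative at [t] of [x] seen as a function on [0, +oo[: the
   two-sided derivative for [0 < t], the right derivative for [t = 0]. *)
Definition has_deriv_ge0 (R : realType) (H : completeNormedModType R)
    (x : R -> H) (t : R) (w : H) : Prop :=
  h^-1 *: (x (t + h) - x t) @[h --> within [set h | 0 <= t + h] 0^'] --> w.

(* Global solutions on [0, +oo[, with [x] of class C^1 and [lam] locally
   Lipschitz there; the values of [x] and [lam] at negative times are
   irrelevant. *)
Definition global_solution (R : realType) (H : completeNormedModType R)
    (A : H -> set H) (theta : R) (x0 : H) (x : R -> H) (lam : R -> R) : Prop :=
  (exists dx : R -> H,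
    [/\ {within `[0, +oo[, continuous dx},
        forall t, 0 <= t -> has_deriv_ge0 x t (dx t)
      & forall t, 0 <= t ->
          dx t + x t - resolvent A (lam t) (x t) = 0]) /\
  [/\ [locally [lipschitz lam t | t in `[0, +oo[%classic]],
      forall t, 0 <= t -> 0 < lam t,
      forall t, 0 <= t ->
        lam t * `|resolvent A (lam t) (x t) - x t| = theta
    & x 0 = x0].

Definition velocity (R : realType) (H : completeNormedModType R)
    (A : H -> set H) (x : R -> H) (lam : R -> R) (t : R) : H :=
  (lam t)^-1 *: (x t - resolvent A (lam t) (x t)).

(* Main.v *)
Require Import Defs.
From mathcomp Require Import all_boot all_order all_algebra.
From mathcomp Require Import all_classical all_reals all_analysis.
From mathcomp Require Import ring lra.
Set Implicit Arguments.
Unset Strict Implicit.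
Unset Printing Implicit Defensive.
Import Order.TTheory GRing.Theory Num.Theory.
Import numFieldNormedType.Exports.
Local Open Scope classical_set_scope.
Local Open Scope ring_scope.

(** Write [w t = x t - J (x t)] for the residual of the resolvent [J] of
    parameter [lam t], so that [x' = - w].  The constraint says
    [lam = theta / `|w|], hence the velocity is [v = (`|w| / theta) w], it lies
    in [A (x - w)], and [`|v| = `|w| ^+ 2 / theta].  Everything is thus governed
    by the decay of [w] and of [d t = dist (x t) S], and [lam] disappears from
    the analysis.

    Monotonicity between [x t - w t] and a zero [z] gives
    [`|w| ^+ 2 <= dot (x - z) w].  So [`|w| <= d], and the squared distance
    [`|x - z| ^+ 2] decreases at rate at least [2 `|w| ^+ 2]
    ([flow_sqr_decrease]).

    The residual tends to 0 ([residual_vanishes]).  The residual is a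
    nonexpansive function of the point ([residual_nonexpansive]) and [x] is
    Lipschitz, so if [`|w t|] exceeds [e] then it exceeds [e / 2] on a time
    interval of fixed length, which costs [`|x - z| ^+ 2] a fixed amount; a
    nonincreasing nonnegative function cannot pay it at arbitrarily late times.

    Once [w] is small, so is [v], and the error bound at [x - w] gives
    [d <= `|w| + kappa `|w| ^+ 2 / theta], that is [a d <= `|w|] with [a < 1]
    as close to 1 as desired.  Feeding this into the decrease of
    [`|x - z| ^+ 2] and taking the infimum over [z] gives
    [d t ^+ 2 (1 + 2 a ^+ 2 (t - s)) <= d s ^+ 2] ([dist_step]), a discrete form
    of [d' <= - a ^+ 2 d], which yields the rate [alpha < a ^+ 2]
    ([exp_decay_of_steps], [dist_exp_decay]).

    Finally, [`|x - z|] is nonincreasing for every zero [z], so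
    [`|x t - x s| <= 2 d s] for [s <= t]: the trajectory is Cauchy, and its
    distance to the limit is at most [2 d]. The limit is a zero because the
    graph of a maximal monotone operator is closed ([zeros_closed]). *)

(** * Real inner products *)

Section InnerProduct.
Context (R : realType) (H : completeNormedModType R).
Context (dot : {dot H for idfun}).
Context (dot_norm : forall u : H, dot u u = `|u| ^+ 2).
Implicit Types u v w : H.

Lemma dotC u v : dot u v = dot v u.
Proof. by rewrite hermC expr0 mul1r. Qed.

Lemma dotBl u v w : dot (u - v) w = dot u w - dot v w.
Proof. exact: linearBl. Qed.

Lemma dotBr u v w : dot u (v - w) = dot u v - dot u w.
Proof. exact: linearBr. Qed.

Lemma dotZl a u v : dot (a *: u) v = a * dot u v.
Proof. exact: linearZl_LR. Qed.

Lemma dotZr a u v : dot u (a *: v) = a * dot u v.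
Proof. by rewrite linearZr. Qed.

Lemma normB_sqr u v : `|u - v| ^+ 2 = `|u| ^+ 2 - 2 * dot u v + `|v| ^+ 2.
Proof. rewrite -!dot_norm dotBl !dotBr (dotC v u). ring. Qed.

Lemma dot_le u v : dot u v <= `|u| * `|v|.
Proof.
have [->|v0] := eqVneq v 0; first by rewrite linear0r normr0 mulr0.
have vp : 0 < `|v| by rewrite normr_gt0.
have [->|u0] := eqVneq u 0; first by rewrite linear0l normr0 mul0r.
have up : 0 < `|u| by rewrite normr_gt0.
have := sqr_ge0 `| `|v| *: u - `|u| *: v|.
rewrite normB_sqr dotZl dotZr !normrZ !normr_id => h.
have h2 : 0 <= 2 * (`|u| * `|v|) * (`|u| * `|v| - dot u v) by nra.
by rewrite -subr_ge0 -(pmulr_rge0 _ (_ : 0 < 2 * (`|u| * `|v|))) // !mulr_gt0.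
Qed.

Lemma dot_abs_le u v : `|dot u v| <= `|u| * `|v|.
Proof.
rewrite ler_norml dot_le andbT lerNl.
have -> : - dot u v = dot (- u) v by rewrite linearNl.
by rewrite -(normrN u) dot_le.
Qed.

(** With [c = r * s - k] and [k >= 0], the left-hand side of the last hypothesis
    is [L = (r + s) ((r - s) ^+ 2 + k)], while
    [N ^+ 2 = (r + s) ^+ 2 (r - s) ^+ 2 + 2 r s k], whence
    [L ^+ 2 >= (r - s) ^+ 2 N ^+ 2]; and [N] vanishes only if [r = s].  Here [r] and [s] stand for the norms of two
    vectors, [c] for their inner product, and [N] for the norm of the difference
    of the vectors rescaled by their own norms. *)
Lemma norm_gap_le_of_cubic (r s c X N : R) : 0 <= r -> 0 <= s -> 0 <= X -> 0 <= N ->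
  c <= r * s -> N ^+ 2 = r ^+ 4 + s ^+ 4 - 2 * (r * s * c) ->
  r ^+ 3 + s ^+ 3 - (r + s) * c <= X * N -> `|r - s| <= X.
Proof.
move=> r0 s0 X0 N0 crs N2 L.
have [k k0 ck] : exists2 k, 0 <= k & c = r * s - k.
  by exists (r * s - c); rewrite ?subr_ge0 //; ring.
have L' : (r + s) * ((r - s) ^+ 2 + k) <= X * N.
  by apply: le_trans L; rewrite ck le_eqVlt; apply/orP; left; apply/eqP; ring.
have {}N2 : N ^+ 2 = (r + s) ^+ 2 * (r - s) ^+ 2 + 2 * (r * s) * k.
  by rewrite N2 ck; ring.
rewrite leNgt; apply/negP => XD.
set D := `|r - s| in XD.
have D2 : (r - s) ^+ 2 = D ^+ 2 by rewrite /D real_normK ?num_real.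
have D0 : 0 < D by apply: le_lt_trans XD.
rewrite D2 in N2 L'.
have rs0 : 0 < r + s.
  rewrite lt_neqAle addr_ge0 // andbT; apply/eqP => e.
  by move: D0; rewrite /D (_ : r - s = 0) ?normr0 ?ltxx //; lra.
have N0' : 0 < N.
  have : 0 < N ^+ 2 by rewrite N2 ltr_pwDl ?mulr_ge0 ?mulr_gt0 ?exprn_gt0.
  by apply: contraTT; rewrite -!leNgt => N0'; rewrite (_ : N = 0) ?expr0n //; lra.
have LL : (r + s) * (D ^+ 2 + k) < D * N by apply: le_lt_trans L' _; rewrite ltr_pM2r.
have : ((r + s) * (D ^+ 2 + k)) ^+ 2 < (D * N) ^+ 2.
  by rewrite ltr_pXn2r ?nnegrE ?mulr_ge0 ?addr_ge0 ?sqr_ge0 ?(ltW D0).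
rewrite [X in _ < X -> _]exprMn N2 ltNge => /negP; apply.
rewrite -subr_ge0.
have -> : ((r + s) * (D ^+ 2 + k)) ^+ 2 -
   D ^+ 2 * ((r + s) ^+ 2 * D ^+ 2 + 2 * (r * s) * k) =
   2 * (D ^+ 2 * k) * (r ^+ 2 + r * s + s ^+ 2) + ((r + s) * k) ^+ 2 by ring.
have D2k : 0 <= D ^+ 2 * k by rewrite mulr_ge0 ?sqr_ge0.
have rs2 : 0 <= r ^+ 2 + r * s + s ^+ 2 by rewrite !addr_ge0 ?sqr_ge0 ?mulr_ge0.
by rewrite addr_ge0 ?sqr_ge0 // mulr_ge0 // mulr_ge0.
Qed.

End InnerProduct.

(** * Calculus on the closed half-line *)

Section HalfLineDerivative.
Context (R : realType) (H : completeNormedModType R).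
Implicit Types (f : R -> H).

(** Continuity relative to the half-line, from boundedness of the difference
    quotients. *)
Lemma has_deriv_ge0_near f u w : has_deriv_ge0 f u w ->
  forall e : R, 0 < e -> \forall h \near nbhs (0 : R), 0 <= u + h -> `|f (u + h) - f u| <= e.
Proof.
move=> fw e e0.
have nQ : \forall h \near nbhs (0 : R), h != 0 -> 0 <= u + h ->
    `|h^-1 *: (f (u + h) - f u)| <= `|w| + 1.
  exact: (@cvgr_norm_le _ _ _ _ _ _ _ fw (`|w| + 1) (ltr_pwDr ltr01 (lexx _))).
have c0 : 0 < `|w| + 1 by rewrite ltr_wpDl.
near=> h => uh.
have [->|h0] := eqVneq h 0; first by rewrite addr0 subrr normr0 ltW.
have : `|h^-1 *: (f (u + h) - f u)| <= `|w| + 1.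
  by move: uh h0; near: h; apply: filterS nQ => h nh uh h0; exact: nh.
rewrite normrZ normfV ler_pdivrMl ?normr_gt0 // => /le_trans; apply.
rewrite -ler_pdivlMr //.
near: h; exact: (@nbhs0_le R R^o _ (divr_gt0 e0 c0)).
Unshelve. all: by end_near. Qed.
End HalfLineDerivative.

Lemma has_deriv_ge0_is_derive (R : realType) (f : R -> R) (u w : R) : 0 < u ->
  has_deriv_ge0 (f : R -> R^o) u w -> is_derive u 1 f w.
Proof.
move=> u0 fw.
have fw' : h^-1 *: ((f \o shift u) (h *: 1) - f u) @[h --> (0 : R)^'] --> w.
  apply/cvgrPdist_le => e e0.
  have nV : \forall h \near (0 : R)^', 0 <= u + h ->
      `|w - h^-1 *: (f (u + h) - f u)| <= e.
    by move/cvgrPdist_le : fw => /(_ e e0).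
  near=> h.
  rewrite /= scaler1 (addrC h); near: h; apply: filterS2 nV (@dnbhs0_le R R^o _ u0) => h + hu.
  by apply; rewrite -lerBlDl sub0r; move: hu; rewrite ler_norml => /andP[].
apply: DeriveDef; first by apply/cvg_ex; exists w.
exact/cvg_lim.
Unshelve. all: by end_near.
Qed.

(** The one-sided derivative at 0 makes [f] continuous up to the endpoint
    [s = 0]; inside the interval the derivative is the usual one. *)
Lemma has_deriv_ge0_MVT (R : realType) (f df : R -> R) (s t : R) :
  (forall u, 0 <= u -> has_deriv_ge0 (f : R -> R^o) u (df u)) -> 0 <= s -> s <= t ->
  exists2 c, c \in `[s, t] & f t - f s = df c * (t - s).
Proof.
move=> fd s0 st; apply: MVT_segment => //.
- move=> u; rewrite in_itv /= => /andP[su ut].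
  have u0 : 0 < u by rewrite (le_lt_trans s0).
  by apply: has_deriv_ge0_is_derive => //; apply/fd/ltW.
- refine ((@subspace_continuousP R `[s,t]%classic R^o f).2 _) => u.
  rewrite /= in_itv /= => /andP[su ut].
  apply/cvgrPdist_le => e e0.
  have := has_deriv_ge0_near (fd u (le_trans s0 su)) e0.
  rewrite near_withinE => nf.
  have : \forall z \near u, 0 <= z -> `|f z - f u| <= e.
    rewrite (near_shift (0 : R^o)); apply: filterS nf => h.
    by rewrite /= subr0 (addrC h).
  apply: filterS => z hz; rewrite /= in_itv /= => /andP[sz zt].
  by rewrite distrC hz // (le_trans s0).
Qed.

Section DerivativeOfForms.
Context (R : realType) (H : completeNormedModType R).
Context (dot : {dot H for idfun}).
Context (dot_norm : forall u : H, dot u u = `|u| ^+ 2).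
Implicit Types u v w : H.

Lemma cvg_dotr u (F : set_system R) (FF : Filter F) (f : R -> H) w :
  f h @[h --> F] --> w -> dot u (f h) @[h --> F] --> dot u w.
Proof.
move=> fw.
have c0 : 0 < `|u| + 1 by rewrite ltr_wpDl.
apply/cvgrPdist_le => e e0.
move/cvgrPdist_le : fw => /(_ _ (divr_gt0 e0 c0)); apply: filterS => h.
rewrite ler_pdivlMr // -dotBr => hh.
apply: le_trans (dot_abs_le dot_norm _ _) _; rewrite mulrC; apply: le_trans hh.
by rewrite ler_wpM2l // lerDl.
Qed.

Lemma has_deriv_ge0_dot u (x : R -> H) t w : has_deriv_ge0 x t w ->
  has_deriv_ge0 ((fun s => dot u (x s)) : R -> R^o) t (dot u w).
Proof.
move=> /(cvg_dotr (u := u)); rewrite /has_deriv_ge0.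
by under eq_fun do rewrite dotZr dotBr.
Qed.

Lemma has_deriv_ge0_sqr z (x : R -> H) t w : has_deriv_ge0 x t w ->
  has_deriv_ge0 ((fun s => `|x s - z| ^+ 2) : R -> R^o) t (2 * dot (x t - z) w).
Proof.
move=> xw.
pose Q h := h^-1 *: (x (t + h) - x t).
(* The quotient of the square splits as 2 dot (x t - z) Q + h |Q|^2; the last term vanishes. *)
have Qe : (fun h => 2 * dot (x t - z) (Q h) + h * `|Q h| ^+ 2) =
   (fun h => h^-1 *: ((`|x (t + h) - z| ^+ 2 : R^o) - `|x t - z| ^+ 2)).
  apply/funext => h; rewrite /Q.
  have [->|h0] := eqVneq h 0; first by rewrite invr0 !scale0r linear0r mul0r mulr0 addr0.
  set D := x (t + h) - x t.
  have -> : x (t + h) - z = D - (z - x t) by rewrite /D opprB subrKA.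
  have DzE : dot D (z - x t) = - dot (x t - z) D.
    by rewrite dotBr dotBl !(dotC dot D) opprB.
  rewrite (normB_sqr dot_norm) DzE -(opprB (x t) z) normrN dotZr normrZ normfV.
  rewrite exprMn exprVn real_normK ?num_real //.
  by rewrite /GRing.scale /=; field.
rewrite /has_deriv_ge0 -Qe.
have h0 : (h @[h --> within [set h | 0 <= t + h] (0 : R)^'] --> (0 : R)).
  by apply: cvg_trans (@cvg_within _ _ _ _) _; exact: nbhs_dnbhs.
have -> : 2 * dot (x t - z) w = 2 * dot (x t - z) w + 0 * (`|w| ^+ 2) by rewrite mul0r addr0.
apply: cvgD.
  by apply: cvgM; [exact: cvg_cst | exact: cvg_dotr].
by apply: cvgM => //; apply: cvgM; exact: cvg_norm.
Qed.
End DerivativeOfForms.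

(** * Distance to a set *)

Section Distance.
Context (R : realType) (H : completeNormedModType R).
Implicit Types (S : set H) (y z : H).

Lemma dist_le S y z : S z -> dist y S <= `|y - z|.
Proof. by move=> Sz; apply: ge_inf; [exists 0 => _ [? _ <-] | exists z]. Qed.

Lemma le_dist S y (c : R) : S !=set0 -> (forall z, S z -> c <= `|y - z|) -> c <= dist y S.
Proof.
move=> [z Sz] cz; apply: lb_le_inf; first by exists `|y - z|; exists z.
by move=> _ [v Sv <-]; exact: cz.
Qed.

Lemma dist_ge0 S y : S !=set0 -> 0 <= dist y S.
Proof. by move=> S0; apply: le_dist. Qed.

Lemma dist_triangle S y z : S !=set0 -> dist y S <= `|y - z| + dist z S.
Proof.
move=> S0; rewrite -lerBlDl; apply: le_dist => // v Sv; rewrite lerBlDl.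
by apply: le_trans (ler_distD z _ _); apply: dist_le.
Qed.
End Distance.

(** * Residuals of a monotone operator *)

Section Residual.
Context (R : realType) (H : completeNormedModType R) (dot : {dot H for idfun}).
Context (dot_norm : forall u : H, dot u u = `|u| ^+ 2).
Context (A : H -> set H) (theta : R).
Context (A_mono : Defs.monotone dot A) (theta0 : 0 < theta).

(** Monotonicity, Cauchy-Schwarz and expansion of the inner products reduce this
    to the scalar inequality [norm_gap_le_of_cubic].  Along a trajectory it
    forbids sudden changes of the residual, which is what makes its square
    integrability imply its decay. *)
Lemma residual_nonexpansive (x1 x2 w1 w2 : H) :
  A (x1 - w1) ((`|w1| / theta) *: w1) -> A (x2 - w2) ((`|w2| / theta) *: w2) ->
  `| `|w1| - `|w2| | <= `|x1 - x2|.
Proof.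
move=> /A_mono A1 /A1.
have -> : (`|w1| / theta) *: w1 - (`|w2| / theta) *: w2 =
    theta^-1 *: (`|w1| *: w1 - `|w2| *: w2).
  by rewrite scalerBr !scalerA ![theta^-1 * _]mulrC.
rewrite dotZr pmulr_rge0 ?invr_gt0 //; set p := _ *: w1 - _.
have -> : x1 - w1 - (x2 - w2) = (x1 - x2) - (w1 - w2).
  by rewrite !opprB addrACA [RHS]addrACA (addrC (- w1)).
rewrite dotBl subr_ge0 => le.
apply: (@norm_gap_le_of_cubic _ `|w1| `|w2| (dot w1 w2) _ `|p|) => //.
- exact: dot_le.
- rewrite /p (normB_sqr dot_norm) !normrZ !normr_id dotZl dotZr; ring.
- apply: le_trans (dot_le dot_norm (x1 - x2) p); apply: le_trans le.
  rewrite le_eqVlt; apply/orP; left; apply/eqP.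
  rewrite /p dotBl !dotBr !dotZr !dot_norm (dotC dot w2); ring.
Qed.

Lemma residual_sqr_le (y w z : H) : zeros A z -> 0 < `|w| ->
  A (y - w) ((`|w| / theta) *: w) -> `|w| ^+ 2 <= dot (y - z) w.
Proof.
move=> Az w0 /A_mono /(_ Az).
rewrite subr0 dotZr pmulr_rge0 ?divr_gt0 // (addrAC y) (dotBl dot (y - z)) dot_norm.
by rewrite subr_ge0.
Qed.

Lemma residual_le (y w z : H) : zeros A z -> 0 < `|w| ->
  A (y - w) ((`|w| / theta) *: w) -> `|w| <= `|y - z|.
Proof.
move=> Az w0 /(residual_sqr_le Az w0) /le_trans /(_ (dot_le dot_norm _ _)).
by rewrite expr2 ler_pM2r.
Qed.

(** The monotone inequalities pass to the limit, so adding the pair [(u, 0)] to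
    the graph of [A] keeps it monotone; maximality then puts it in [A]. *)
Lemma zeros_closed (u : H) : maximal_monotone dot A ->
  (forall e : R, 0 < e -> exists y v, [/\ A y v, `|y - u| <= e & `|v| <= e]) ->
  zeros A u.
Proof.
move=> [_ Amax] near0.
have u0 z v : A z v -> 0 <= dot (z - u) v.
  move=> Azv; apply/ler_addgt0Pr => e e0.
  (* An e / c approximation changes dot (z - u) v by at most e, and c >= 2 leaves room for the
     second-order term, kept below e / c by the bound 1 on |y - u|. *)
  pose c := `|v| + `|z - u| + 2.
  have c2 : 2 <= c by rewrite /c lerDr addr_ge0.
  have c0 : 0 < c by apply: lt_le_trans c2.
  have [|y [y' [Ay yu y'1]]] := near0 (Num.min 1 (e / c)); first by rewrite lt_min ltr01 divr_gt0.
  move: yu y'1; rewrite !le_min => /andP[yu1 yue] /andP[y'1 y'e].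
  have := A_mono Azv Ay.
  have -> : z - y = (z - u) - (y - u) by rewrite opprB subrKA.
  rewrite dotBl !dotBr => h.
  have bound p q (b : R) : `|p| * `|q| <= b -> - b <= dot p q <= b.
    by move=> pq; rewrite -ler_norml; apply: le_trans pq; exact: dot_abs_le.
  have h1 : `|z - u| * `|y'| <= `|z - u| * (e / c) by rewrite ler_wpM2l.
  have h2 : `|y - u| * `|y'| <= e / c.
    by rewrite -[e / c]mul1r ler_pM.
  have h3 : `|y - u| * `|v| <= (e / c) * `|v| by rewrite ler_wpM2r.
  move: (bound _ _ _ h1) (bound _ _ _ h2) (bound _ _ _ h3).
  move=> /andP[h1' _] /andP[_ h2'] /andP[h3' _].
  have ec : e = e / c * (`|v| + `|z - u| + 2) by rewrite -/c divfK // gt_eqF.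
  have ec0 : 0 < e / c by rewrite divr_gt0.
  nra.
pose B y := A y `|` [set v | y = u /\ v = 0].
have BA : B u = A u.
  apply: (Amax B) => [|y v Ayv]; last by left.
  move=> y z v w [Ayv|[-> ->]] [Azw|[-> ->]].
  - exact: A_mono.
  - by rewrite subr0; exact: u0.
  - by rewrite sub0r -(opprB z u) linearNl linearNr opprK; exact: u0.
  - by rewrite !subrr linear0l.
by rewrite /zeros /= -BA; right.
Qed.
End Residual.

(** * The residual flow *)

Section Flow.
Context (R : realType) (H : completeNormedModType R) (dot : {dot H for idfun}).
Context (dot_norm : forall u : H, dot u u = `|u| ^+ 2).
Context (A : H -> set H) (theta : R).
Context (A_mono : Defs.monotone dot A) (theta0 : 0 < theta).
Context (x w : R -> H).
Context (x_deriv : forall t, 0 <= t -> has_deriv_ge0 x t (- w t)).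
Context (w_gt0 : forall t, 0 <= t -> 0 < `|w t|).
Context (Aw : forall t, 0 <= t -> A (x t - w t) ((`|w t| / theta) *: w t)).
Context (S_neq0 : zeros A !=set0).

(** The derivative of [`|x - z| ^+ 2] is [- 2 dot (x - z) w], which is at most
    [- 2 `|w| ^+ 2] by monotonicity. *)
Lemma flow_sqr_decrease z (m s t : R) : zeros A z -> 0 <= s -> s <= t ->
  (forall u, s <= u -> u <= t -> m <= `|w u| ^+ 2) ->
  `|x t - z| ^+ 2 <= `|x s - z| ^+ 2 - 2 * m * (t - s).
Proof.
move=> Az s0 st mw.
have [|c] := @has_deriv_ge0_MVT R (fun u => `|x u - z| ^+ 2)
   (fun u => 2 * dot (x u - z) (- w u)) s t _ s0 st.
  by move=> u u0; apply: has_deriv_ge0_sqr => //; exact: x_deriv.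
rewrite in_itv /= => /andP[sc ct] e.
have c0 : 0 <= c by apply: le_trans sc.
rewrite -lerBlDl e -mulNr ler_wpM2r ?subr_ge0 // -mulrN ler_wpM2l //.
rewrite linearNr lerN2; apply: le_trans (mw _ sc ct) _.
exact: (residual_sqr_le dot_norm A_mono theta0 Az (w_gt0 c0) (Aw c0)).
Qed.

Lemma flow_fejer z (s t : R) : zeros A z -> 0 <= s -> s <= t ->
  `|x t - z| <= `|x s - z|.
Proof.
move=> Az s0 st; rewrite -(@ler_pXn2r _ 2) ?nnegrE //.
have := @flow_sqr_decrease z 0 s t Az s0 st.
by rewrite mulr0 mul0r subr0; apply => u _ _; exact: sqr_ge0.
Qed.

(** A vector-valued mean value inequality, obtained by testing against the
    increment itself. *)
Lemma flow_lipschitz (M s t : R) : 0 <= s -> s <= t ->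
  (forall u, s <= u -> u <= t -> `|w u| <= M) ->
  `|x t - x s| <= M * (t - s).
Proof.
move=> s0 st wM; set e := x t - x s.
have [|c] := @has_deriv_ge0_MVT R (fun u => dot e (x u)) (fun u => dot e (- w u)) s t _ s0 st.
  by move=> u u0; apply: has_deriv_ge0_dot => //; exact: x_deriv.
rewrite in_itv /= => /andP[sc ct]; rewrite -dotBr -/e dot_norm => ee.
have [e0|e0] := eqVneq `|e| 0.
  rewrite e0 mulr_ge0 ?subr_ge0 //.
  by apply: le_trans (wM s (lexx _) st).
have ep : 0 < `|e| by rewrite lt0r e0 /=.
rewrite -(ler_pM2l ep) -expr2 ee mulrA ler_wpM2r ?subr_ge0 //.
apply: le_trans (dot_le dot_norm _ _) _.
by rewrite ler_wpM2l // normrN wM.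
Qed.

Lemma residual_le0 z t : zeros A z -> 0 <= t -> `|w t| <= `|x 0 - z|.
Proof.
move=> Az t0; apply: le_trans (flow_fejer Az (lexx 0) t0).
exact: (residual_le dot_norm A_mono theta0 Az (w_gt0 t0) (Aw t0)).
Qed.

Lemma residual_le_dist t : 0 <= t -> `|w t| <= dist (x t) (zeros A).
Proof.
move=> t0; apply: le_dist => // z Az.
exact: (residual_le dot_norm A_mono theta0 Az (w_gt0 t0) (Aw t0)).
Qed.

(** If [`|w t| > e], then [`|w| >= e / 2] on [[t, t + tau]] with
    [tau = e / (2 M)], because [M] is a Lipschitz constant of [x] and the
    residual is nonexpansive.  On that interval [`|x - z| ^+ 2] loses at least
    [2 (e / 2) ^+ 2 tau], which is impossible once it is closer than this to its
    infimum over time. *)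
Lemma residual_vanishes (e : R) : 0 < e ->
  exists2 T, 0 <= T & forall t, T <= t -> `|w t| <= e.
Proof.
move=> e0; have [z Az] := S_neq0.
pose M := `|x 0 - z|.
have M0 : 0 < M by apply: lt_le_trans (w_gt0 (lexx 0)) (residual_le0 Az (lexx 0)).
pose tau := e / (2 * M).
have tau0 : 0 < tau by rewrite divr_gt0 // mulr_gt0.
pose E := [set `|x t - z| ^+ 2 | t in [set t | 0 <= t]].
have E0 : has_inf E.
  split; first by exists (`|x 0 - z| ^+ 2); exists 0 => //=.
  by exists 0 => _ [t _ <-]; exact: sqr_ge0.
have eta0 : 0 < 2 * (e / 2) ^+ 2 * tau by rewrite mulr_gt0 // mulr_gt0 // exprn_gt0 // divr_gt0.
have [_ [T T0 <-] fT] := inf_adherent eta0 E0.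
exists T => // t Tt; rewrite leNgt; apply/negP => ew.
have t0 : 0 <= t by apply: le_trans Tt.
have ttau : t <= t + tau by rewrite lerDl ltW.
have le1 : `|x (t + tau) - z| ^+ 2 <= `|x t - z| ^+ 2 - 2 * (e / 2) ^+ 2 * (t + tau - t).
  apply: flow_sqr_decrease => // u tu ut.
  have u0 : 0 <= u by apply: le_trans tu.
  rewrite ler_pXn2r ?nnegrE ?divr_ge0 ?(ltW e0) //.
  have Lip : `|x u - x t| <= M * (u - t).
    apply: flow_lipschitz => // v tv _; apply: residual_le0 => //.
    by apply: le_trans tv.
  have {}Lip : `|x u - x t| <= e / 2.
    apply: le_trans Lip _.
    have -> : e / 2 = M * tau by rewrite /tau; field; rewrite gt_eqF.
    by rewrite ler_pM2l // lerBlDl.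
  have := residual_nonexpansive dot_norm A_mono theta0 (Aw u0) (Aw t0).
  move=> /le_trans /(_ Lip); rewrite ler_norml => /andP[+ _].
  move: ew; lra.
have le2 : `|x t - z| ^+ 2 <= `|x T - z| ^+ 2.
  by rewrite ler_pXn2r ?nnegrE //; exact: flow_fejer.
have le3 : inf E <= `|x (t + tau) - z| ^+ 2.
  apply: ge_inf; first by case: E0.
  by exists (t + tau) => //=; rewrite addr_ge0 // ltW.
move: fT le1 le2 le3; rewrite (addrC t) addrK; lra.
Qed.

Lemma dist_nonincreasing (s t : R) : 0 <= s -> s <= t ->
  dist (x t) (zeros A) <= dist (x s) (zeros A).
Proof.
move=> s0 st; apply: le_dist => // z Az.
by apply: le_trans (flow_fejer Az s0 st); exact: dist_le.
Qed.

(** On [[s, t]] the residual is at least [a] times the distance at the final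
    time, since the distance is nonincreasing; the decrease of
    [`|x - z| ^+ 2] is then uniform in the zero [z], so that
    the infimum over [z] can be taken on both sides. *)
Lemma dist_step (a s t : R) : 0 <= a -> 0 <= s -> s <= t ->
  (forall u, s <= u -> u <= t -> a * dist (x u) (zeros A) <= `|w u|) ->
  dist (x t) (zeros A) ^+ 2 * (1 + 2 * a ^+ 2 * (t - s)) <= dist (x s) (zeros A) ^+ 2.
Proof.
move=> a0 s0 st aw; set d := dist (x t) _; set q := _ * _.
have d0 : 0 <= d by exact: dist_ge0.
have qz z : zeros A z -> q <= `|x s - z| ^+ 2.
  move=> Az.
  have := @flow_sqr_decrease z ((a * d) ^+ 2) s t Az s0 st.
  have -> : q = d ^+ 2 + 2 * (a * d) ^+ 2 * (t - s) by rewrite /q; ring.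
  move=> dec; rewrite -lerBrDr; apply: le_trans (dec _).
    by rewrite ler_pXn2r ?nnegrE //; exact: dist_le.
  move=> u su ut; have u0 : 0 <= u by apply: le_trans su.
  rewrite ler_pXn2r ?nnegrE ?mulr_ge0 //; apply: le_trans (aw u su ut).
  by rewrite ler_wpM2l //; exact: dist_nonincreasing.
have q0 : 0 <= q.
  by rewrite mulr_ge0 ?sqr_ge0 // addr_ge0 // !mulr_ge0 ?subr_ge0 // sqr_ge0.
rewrite -(sqr_sqrtr q0) ler_pXn2r ?nnegrE ?sqrtr_ge0 ?dist_ge0 //.
apply: le_dist => // z Az.
by rewrite -(@ler_pXn2r _ 2) ?nnegrE ?sqrtr_ge0 // sqr_sqrtr // qz.
Qed.

(** Going from [x s] to [x t] through a zero [z] costs at most twice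
    [`|x s - z|]. *)
Lemma flow_dist_le (s t : R) : 0 <= s -> s <= t ->
  `|x t - x s| <= 2 * dist (x s) (zeros A).
Proof.
move=> s0 st; rewrite -ler_pdivrMl // ; apply: le_dist => // z Az.
rewrite ler_pdivrMl // mulr_natl mulr2n.
apply: le_trans (ler_distD z _ _) _; rewrite (distrC z).
by rewrite lerD2r flow_fejer.
Qed.
End Flow.

(** * Exponential rate *)

(** For a fixed small step [h] one has
    [expR (2 * alpha * h) <= 1 + 2 * beta * h], so the hypothesis makes [d]
    shrink by [expR (- alpha * h)] at each step after [T]; monotonicity of [d]
    covers the times between steps and before [T], at the price of the factor
    [expR (alpha * (T + h))]. *)
Lemma exp_decay_of_steps (R : realType) (d : R -> R) (alpha beta T : R) :
  0 < alpha -> alpha < beta -> 0 <= T ->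
  (forall t, 0 <= t -> 0 <= d t) ->
  (forall s t, 0 <= s -> s <= t -> d t <= d s) ->
  (forall s t, T <= s -> s <= t ->
     d t ^+ 2 * (1 + 2 * beta * (t - s)) <= d s ^+ 2) ->
  exists2 C, 0 < C & forall t, 0 <= t -> d t <= C * expR (- (alpha * t)).
Proof.
move=> a0 ab T0 d0 dmono step.
have b0 : 0 < beta by apply: lt_trans ab.
(* With this step, both 1 - 2 alpha h = alpha / beta and 1 + 2 beta h = beta / alpha. *)
pose h := (beta - alpha) / (2 * alpha * beta).
have h0 : 0 < h by rewrite divr_gt0 ?subr_gt0 // !mulr_gt0.
have eh : expR (alpha * h) ^+ 2 <= 1 + 2 * beta * h.
  rewrite -expRM_natl.
  have := expR_ge1Dx (- (2 * (alpha * h))).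
  have -> : 1 + - (2 * (alpha * h)) = (beta / alpha)^-1.
    by rewrite invf_div /h; field; rewrite !gt_eqF.
  rewrite expRN lef_pV2 ?posrE ?expR_gt0 ?divr_gt0 // => /le_trans; apply.
  rewrite le_eqVlt; apply/orP; left; apply/eqP.
  by rewrite /h; field; rewrite !gt_eqF.
have pw n : d (T + n%:R * h) <= d 0 * expR (- (alpha * (n%:R * h))).
  elim: n => [|n IH].
    by rewrite !mul0r mulr0 oppr0 expR0 mulr1 addr0 dmono.
  set s := T + n%:R * h in IH *; set t := T + _.
  have Ts : T <= s by rewrite lerDl mulr_ge0 // ltW.
  have tsh : t - s = h by rewrite /t /s -natr1; ring.
  have st : s <= t by rewrite -subr_ge0 tsh ltW.
  have s0 : 0 <= s by apply: le_trans Ts.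
  have ds0 := d0 s s0.
  have dt0 : 0 <= d t by apply: d0; apply: le_trans st.
  have := step s t Ts st; rewrite tsh => hst.
  have : d t * expR (alpha * h) <= d s.
    rewrite -(@ler_pXn2r _ 2) ?nnegrE ?mulr_ge0 ?expR_ge0 //.
    by rewrite exprMn; apply: le_trans hst; rewrite ler_wpM2l ?sqr_ge0.
  move=> /le_trans /(_ IH).
  rewrite -ler_pdivlMr ?expR_gt0 // => /le_trans; apply.
  rewrite -expRN -mulrA -expRD -opprD -mulrDr -natr1 mulrDl mul1r.
  by [].
exists ((d 0 + 1) * expR (alpha * (T + h))).
  by rewrite mulr_gt0 ?expR_gt0 // ltr_wpDl ?d0.
move=> t t0.
rewrite -mulrA -expRD.
have d00 := d0 0 (lexx 0).
have [tT|Tt] := leP t T.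
  apply: le_trans (dmono _ _ (lexx 0) t0) _.
  apply: (@le_trans _ _ (d 0 + 1)); first by rewrite lerDl.
  rewrite ler_peMr ?addr_ge0 // -expR0 ler_expR subr_ge0 ler_pM2l //.
  by apply: le_trans tT _; rewrite lerDl ltW.
pose n := Num.truncn ((t - T) / h).
have /truncn_itv : 0 <= (t - T) / h by rewrite divr_ge0 ?subr_ge0 // ltW.
rewrite -/n => /andP[]; rewrite ler_pdivlMr // ltr_pdivrMr // => nt tn.
apply: (@le_trans _ _ (d (T + n%:R * h))).
  have sn : 0 <= T + n%:R * h by rewrite addr_ge0 // mulr_ge0 // ltW.
  by rewrite dmono // addrC -lerBrDr.
apply: le_trans (pw n) _; apply: ler_pM; rewrite ?expR_ge0 ?lerDl //.
rewrite ler_expR lerNl opprB -mulrBr ler_pM2l //.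
by move: tn; rewrite -natr1 mulrDl mul1r ltrBlDl => /ltW; rewrite lerBlDl -addrA (addrC h).
Qed.

(** * Resolvents and convergence *)

(** An empty preimage would make [resolvent] take its default value [y], and
    the product [l * `|resolvent A l y - y|] would be 0 instead of [theta]; so
    the inclusion defining the resolvent holds. *)
Lemma resolvent_residual (R : realType) (H : completeNormedModType R)
    (A : H -> set H) (theta l : R) (y : H) : 0 < theta -> 0 < l ->
  l * `|resolvent A l y - y| = theta ->
  let r := y - resolvent A l y in
  [/\ 0 < `|r|, l^-1 = `|r| / theta & A (y - r) ((`|r| / theta) *: r)].
Proof.
move=> th0 l0 lth r.
have nr : l * `|r| = theta by rewrite -lth distrC.
have r0 : 0 < `|r| by rewrite -(pmulr_rgt0 _ l0) nr.
have lr : l^-1 = `|r| / theta.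
  by rewrite -nr invfM mulrCA divff ?mulr1 // gt_eqF.
split => //; rewrite -lr /r opprB addrCA subrr addr0.
have [z Pz] : exists z, id_plus l A z y.
  apply: contrapT => /forallNP P0; move: r0.
  by rewrite /r /resolvent xgetPN // subrr normr0 ltxx.
have : id_plus l A (resolvent A l y) y.
  by rewrite /resolvent; apply: (xgetPex y (P := [set z | id_plus l A z y])); exists z.
case=> v Av {2}<-.
by rewrite addrC addKr scalerA mulVf ?gt_eqF // scale1r.
Qed.

Section Convergence.
Context (R : realType) (H : completeNormedModType R) (dot : {dot H for idfun}).
Context (dot_norm : forall u : H, dot u u = `|u| ^+ 2).
Context (A : H -> set H) (theta : R).
Context (A_max : maximal_monotone dot A) (theta0 : 0 < theta).
Context (x w : R -> H).
Context (x_deriv : forall t, 0 <= t -> has_deriv_ge0 x t (- w t)).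
Context (w_gt0 : forall t, 0 <= t -> 0 < `|w t|).
Context (Aw : forall t, 0 <= t -> A (x t - w t) ((`|w t| / theta) *: w t)).
Context (S_neq0 : zeros A !=set0).
Let A_mono := proj1 A_max.

(** By [flow_dist_le] the trajectory is Cauchy as soon as the distance to the
    zeros becomes small.  For the limit point, [x - w] and the velocity
    [(`|w| / theta) *: w] form a pair of the graph of [A] converging to
    [(xs, 0)]. *)
Lemma flow_cvg :
  (forall e : R, 0 < e -> exists2 T, 0 <= T & dist (x T) (zeros A) <= e) ->
  exists xs, [/\ zeros A xs, x t @[t --> +oo] --> xs &
    forall t, 0 <= t -> `|x t - xs| <= 2 * dist (x t) (zeros A)].
Proof.
move=> d_small.
have flow_dist := flow_dist_le dot_norm A_mono theta0 x_deriv w_gt0 Aw S_neq0.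
have xc : cvg (x t @[t --> +oo]).
  apply/cauchy_cvgP/cauchy_exP => e e0.
  have [|T T0 dT] := d_small (e / 3); first by rewrite divr_gt0.
  exists (x T).
  suff : \forall t \near +oo, ball (x T) e (x t) by [].
  near=> t.
  have Tt : T <= t by near: t; by apply: nbhs_pinfty_ge; rewrite num_real.
  rewrite -ball_normE /ball_ /= distrC; apply: le_lt_trans (flow_dist _ _ T0 Tt) _.
  by move: dT e0; lra.
have /cvg_ex[xs xxs] := xc.
have near_xs e : 0 < e -> \forall t \near +oo, `|xs - x t| <= e.
  by move=> e0; move/cvgrPdist_le : xxs; exact.
exists xs; split => //.
  apply: (zeros_closed dot_norm A_mono A_max) => e e0.
  have [|T T0 wT] := @residual_vanishes _ _ _ dot_norm _ _ A_mono theta0 _ _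
      x_deriv w_gt0 Aw S_neq0 (Num.min (e / 2) (Num.min 1 (e * theta))).
    by rewrite !lt_min ltr01 divr_gt0 ?mulr_gt0.
  have [t [Tt te]] : exists t, T <= t /\ `|xs - x t| <= e / 2.
    near +oo_R => t; exists t; split; near: t; first by apply: nbhs_pinfty_ge; rewrite num_real.
    by apply: near_xs; rewrite divr_gt0.
  have t0 : 0 <= t by apply: le_trans Tt.
  have := wT t Tt; rewrite !le_min => /andP[we /andP[w1 wth]].
  exists (x t - w t), ((`|w t| / theta) *: w t); split; first exact: Aw.
    rewrite addrAC; apply: le_trans (ler_normB _ _) _.
    by rewrite distrC; move: we te; lra.
  rewrite normrZ normrM normfV normr_id (gtr0_norm theta0) mulrAC ler_pdivrMr //.
  by apply: le_trans wth; rewrite ler_piMl.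
move=> t t0; apply/ler_addgt0Pr => e e0.
have [u [tu ue]] : exists u, t <= u /\ `|xs - x u| <= e.
  near +oo_R => u; exists u; split; near: u; first by apply: nbhs_pinfty_ge; rewrite num_real.
  exact: near_xs.
apply: le_trans (ler_distD (x u) _ _) _; rewrite lerD //; last by rewrite distrC.
by rewrite distrC; exact: flow_dist.
Unshelve. all: by end_near. Qed.

(** With [a = (1 + alpha) / 2] one has
    [a ^+ 2 - alpha = ((1 - alpha) / 2) ^+ 2 > 0], so it suffices to reach
    [a * d <= `|w|].  The error bound gives [d <= `|w| * (1 + (1 - a))] when
    [`|w| <= theta * (1 - a) / kappa], and [a * (1 + (1 - a)) <= 1]. *)
Lemma dist_exp_decay (eps kappa alpha : R) : 0 < eps -> 0 < kappa ->
  (forall y v, A y v -> `|v| <= eps -> dist y (zeros A) <= kappa * `|v|) ->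
  0 < alpha -> alpha < 1 ->
  exists2 C, 0 < C & forall t, 0 <= t ->
    dist (x t) (zeros A) <= C * expR (- (alpha * t)).
Proof.
move=> e0 k0 eb a0 a1.
pose a := (1 + alpha) / 2.
have ap : 0 < a by rewrite divr_gt0 // addr_gt0.
have alt : a < 1 by rewrite /a; lra.
have [|T T0 wT] := @residual_vanishes _ _ _ dot_norm _ _ A_mono theta0 _ _
    x_deriv w_gt0 Aw S_neq0 (Num.min (theta * (1 - a) / kappa) (Num.sqrt (eps * theta))).
  by rewrite lt_min sqrtr_gt0 !mulr_gt0 ?invr_gt0 ?subr_gt0.
have adw t : T <= t -> a * dist (x t) (zeros A) <= `|w t|.
  move=> Tt; have t0 : 0 <= t by apply: le_trans Tt.
  have := wT t Tt; rewrite le_min => /andP[wk wsq].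
  have nv : `|(`|w t| / theta) *: w t| = `|w t| ^+ 2 / theta.
    by rewrite normrZ normrM normfV normr_id (gtr0_norm theta0) mulrAC expr2.
  have veps : `|(`|w t| / theta) *: w t| <= eps.
    rewrite nv ler_pdivrMr // -(@sqr_sqrtr _ (eps * theta)) ?mulr_ge0 ?(ltW e0) ?(ltW theta0) //.
    by rewrite ler_pXn2r ?nnegrE ?sqrtr_ge0.
  have := eb _ _ (Aw t0) veps; rewrite nv => dy.
  have dx := dist_triangle (x t) (x t - w t) S_neq0.
  rewrite opprB addrCA subrr addr0 in dx.
  have le1 : dist (x t) (zeros A) <= `|w t| * (1 + (1 - a)).
    apply: le_trans dx _; rewrite mulrDr mulr1 lerD2l; apply: le_trans dy _.
    have -> : kappa * (`|w t| ^+ 2 / theta) = `|w t| * (`|w t| * kappa / theta) by ring.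
    by rewrite ler_wpM2l // ler_pdivrMr // -ler_pdivlMr // (mulrC (1 - a)).
  apply: (@le_trans _ _ (a * (`|w t| * (1 + (1 - a))))); first by rewrite ler_wpM2l // ltW.
  have -> : a * (`|w t| * (1 + (1 - a))) = `|w t| * (1 - (1 - a) ^+ 2) by ring.
  by rewrite ler_piMr // gerDl oppr_le0 sqr_ge0.
apply: (@exp_decay_of_steps _ (fun t => dist (x t) (zeros A)) alpha (a ^+ 2) T) => //.
- rewrite -subr_gt0 (_ : _ - _ = ((1 - alpha) / 2) ^+ 2); last by rewrite /a; field.
  by rewrite exprn_gt0 // divr_gt0 // subr_gt0.
- by move=> t _; exact: dist_ge0.
- by move=> s t; exact: (dist_nonincreasing dot_norm A_mono theta0 x_deriv w_gt0 Aw S_neq0).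
- move=> s t Ts st.
  apply: (dist_step dot_norm A_mono theta0 x_deriv w_gt0 Aw S_neq0) => //.
  + exact: ltW.
  + exact: le_trans Ts.
  + by move=> u su _; apply: adw; apply: le_trans su.
Qed.
End Convergence.

Theorem theorem3p3 (R : realType) (H : completeNormedModType R)
    (dot : {dot H for idfun}) (dot_norm : forall u : H, dot u u = `|u| ^+ 2)
    (A : H -> set H) (A_max : maximal_monotone dot A)
    (theta : R) (theta_gt0 : 0 < theta)
    (S_neq0 : zeros A !=set0)
    (error_bound : exists eps kappa : R, [/\ 0 < eps, 0 < kappa &
       forall y v : H, A y v -> `|v| <= eps ->
         dist y (zeros A) <= kappa * `|v|])
    (x0 : H) (x0_notin : ~ zeros A x0)
    (x : R -> H) (lam : R -> R)
    (sol : global_solution A theta x0 x lam) :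
  exists xs : H,
    [/\ zeros A xs,
        x t @[t --> +oo] --> xs
      & forall alpha : R, 0 < alpha -> alpha < 1 ->
        exists c0 c1 c2 c3 : R,
          [/\ 0 < c0, 0 < c1, 0 < c2 & 0 < c3] /\
          forall t : R, 0 <= t ->
            [/\ dist (x t) (zeros A) <= c0 * expR (- (alpha * t)),
                c1 * expR (alpha * t) <= lam t,
                `|velocity A x lam t| <= c2 * expR (- (2 * alpha * t))
              & `|x t - xs| <= c3 * expR (- (alpha * t))]].
Proof.
case: error_bound => eps [kappa [eps0 kappa0 eb]].
case: sol => -[dx [_ x_dx dx_eq]] [_ lam0 lam_eq _].
pose w t := x t - resolvent A (lam t) (x t).
have res t (t0 : 0 <= t) := resolvent_residual theta_gt0 (lam0 t t0) (lam_eq t t0).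
have x_deriv t : 0 <= t -> has_deriv_ge0 x t (- w t).
  move=> t0; rewrite (_ : - w t = dx t); first exact: x_dx.
  apply/eqP; rewrite -subr_eq0 -oppr_eq0 opprB opprK; apply/eqP.
  by rewrite -[RHS](dx_eq t t0) /w addrA.
have w_gt0 t : 0 <= t -> 0 < `|w t| by move=> /res[].
have lam_inv t : 0 <= t -> (lam t)^-1 = `|w t| / theta by move=> /res[].
have Aw t : 0 <= t -> A (x t - w t) ((`|w t| / theta) *: w t) by move=> /res[].
have decay := dist_exp_decay dot_norm A_max theta_gt0 x_deriv w_gt0 Aw S_neq0
  eps0 kappa0 eb.
have [|xs [Sxs xxs dxs]] := flow_cvg dot_norm A_max theta_gt0 x_deriv w_gt0 Aw S_neq0.
  move=> e e0; have [||C C0 dC] := decay (2^-1); [lra | lra | ].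
  (* At this time expR (t / 2) >= 1 + C / e, so C * expR (- t / 2) <= e. *)
  exists (2 * C / e); first by rewrite divr_ge0 ?mulr_ge0 // ltW.
  have [t0 le1] : 0 <= 2 * C / e /\ 1 + C / e <= expR (2^-1 * (2 * C / e)).
    split; first by rewrite divr_ge0 ?mulr_ge0 // ltW.
    apply: le_trans (expR_ge1Dx _); rewrite le_eqVlt; apply/orP; left; apply/eqP.
    by field; rewrite gt_eqF.
  apply: le_trans (dC _ t0) _; rewrite expRN ler_pdivrMr ?expR_gt0 //.
  apply: (@le_trans _ _ (e * (1 + C / e))); last by rewrite ler_pM2l.
  by rewrite mulrDr mulr1 mulrCA divff ?gt_eqF // mulr1 lerDr ltW.
exists xs; split => // alpha alpha0 alpha1.
have [C C0 dC] := decay alpha alpha0 alpha1.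
exists C, (theta / C), (C ^+ 2 / theta), (2 * C); split.
  by split => //; rewrite ?divr_gt0 ?mulr_gt0 ?exprn_gt0.
move=> t t0.
have wC : `|w t| <= C * expR (- (alpha * t)).
  apply: le_trans (dC t t0).
  exact: (residual_le_dist dot_norm (proj1 A_max) theta_gt0 w_gt0 Aw S_neq0 t0).
split; first exact: dC.
- rewrite -[lam t]invrK lam_inv // -[expR _]invrK -expRN invf_div.
  rewrite -mulrA -invfM ler_pM2l // lef_pV2 ?posrE ?w_gt0 //.
  by rewrite mulr_gt0 ?expR_gt0.
- rewrite /velocity lam_inv // normrZ normrM normfV normr_id (gtr0_norm theta_gt0).
  rewrite mulrAC [X in _ <= X]mulrAC ler_pM2r ?invr_gt0 // -expr2.
  have -> : - (2 * alpha * t) = 2%:R * - (alpha * t) by ring.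
  by rewrite expRM_natl -exprMn ler_pXn2r ?nnegrE ?mulr_ge0 ?expR_ge0 ?(ltW C0).
- apply: le_trans (dxs t t0) _; rewrite -mulrA ler_pM2l //.
  exact: dC.
Qed.
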